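(* Let $(X,\mathcal{B},\eta)$ be a finite and complete measure space which is additionally separable and non-atomic. Let $-\infty<\alpha<\beta<+\infty$, let $\mathcal{U}_{\mathrm{ad}}=\{u\in L^\infty(X): \alpha\le u(x)\le\beta \text{ for a.a. } x\in X\}$, and let $J:\mathcal{U}_{\mathrm{ad}}\to\mathbb{R}$ be weak* sequentially continuous, i.e. $J(u_k)\to J(u)$ whenever $u_k,u\in\mathcal{U}_{\mathrm{ad}}$ and $u_k\to u$ weak* in $L^\infty(X)$. Suppose that $\bar u\in\mathcal{U}_{\mathrm{ad}}$ is a local minimizer, in the sense of $L^1(X)$, of the problem of minimizing $J(u)$ subject to $u\in\mathcal{U}_{\mathrm{ad}}$, and that $\bar u$ is not bang-bang. Then there exists $\delta_0>0$ such that for any $\delta\in(0,\delta_0]$ and for any $\varepsilon>0$ there exists $u\in\mathcal{U}_{\mathrm{ad}}$ with $$\|u-\bar u\|_{L^1(X)}=\delta\quad\text{and}\quad J(u)\le J(\bar u)+\varepsilon .$$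
   Context: The measure space is non-atomic if for all $A\in\mathcal{B}$ with $\eta(A)>0$ there is $B\in\mathcal{B}$ with $B\subset A$ and $0<\eta(B)<\eta(A)$. It is separable if there is a countable family $\{A_n\}\subset\mathcal{B}$ such that for all $A\in\mathcal{B}$ and $\varepsilon>0$ there is some $A_n$ with $\eta((A\setminus A_n)\cup(A_n\setminus A))<\varepsilon$. A control $\bar u\in\mathcal{U}_{\mathrm{ad}}$ is bang-bang if $\bar u(x)\in\{\alpha,\beta\}$ for a.a. $x\in X$. A local minimizer in the sense of $L^1(X)$ is a $\bar u\in\mathcal{U}_{\mathrm{ad}}$ for which there is $r>0$ with $J(\bar u)\le J(u)$ for all $u\in\mathcal{U}_{\mathrm{ad}}$ with $\|u-\bar u\|_{L^1(X)}<r$. *)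

(* Defs.v *)
From HB Require Import structures.
From mathcomp Require Import all_boot all_order all_algebra.
From mathcomp Require Import all_classical all_reals all_analysis.

Set Implicit Arguments.
Unset Strict Implicit.
Unset Printing Implicit Defensive.

Import Order.TTheory GRing.Theory Num.Theory.
Import numFieldNormedType.Exports.

Local Open Scope classical_set_scope.
Local Open Scope ring_scope.

Definition non_atomic d (T : measurableType d) (R : realType)
    (eta : {measure set T -> \bar R}) : Prop :=
  forall A : set T, measurable A -> (0 < eta A)%E ->
    exists B : set T,
      [/\ measurable B, B `<=` A, (0 < eta B)%E & (eta B < eta A)%E].

Definition separable_measure d (T : measurableType d) (R : realType)
    (eta : {measure set T -> \bar R}) : Prop :=
  exists A_ : nat -> set T,
    (forall n, measurable (A_ n)) /\
    forall (A : set T) (e : R), measurable A -> 0 < e ->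
      exists n, (eta ((A `\` A_ n) `|` (A_ n `\` A)) < e%:E)%E.

(* The library's Lebesgue spaces consist of classes modulo a.e. equality; an
   element coerces to a function by the choice of a representative. The notions
   below do not depend on that choice. *)
Definition Linfty d (T : measurableType d) (R : realType)
    (eta : {measure set T -> \bar R}) : Type :=
  LspaceType eta (leey 1%E).

Definition Uad d (T : measurableType d) (R : realType)
    (eta : {measure set T -> \bar R}) (alpha beta : R) : set (Linfty eta) :=
  [set u : Linfty eta | \forall x \ae eta, alpha <= (u x : R) <= beta].
Arguments Uad {d T R} eta alpha beta.

Definition L1dist d (T : measurableType d) (R : realType)
    (eta : {measure set T -> \bar R}) (u v : Linfty eta) : \bar R :=
  ('N[eta]_1[(fun x => ((u x : R) - (v x : R))%:E)])%E.

(* Weak* convergence with respect to the duality of L^oo with L^1. *)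
Definition weak_star_cvg d (T : measurableType d) (R : realType)
    (eta : {measure set T -> \bar R}) (u_ : nat -> Linfty eta)
    (u : Linfty eta) : Prop :=
  forall g : LspaceType1 eta,
    (\int[eta]_x ((g x : R) * (u_ k x : R))) @[k --> \oo] -->
    (\int[eta]_x ((g x : R) * (u x : R)) : R).

Definition weak_star_seq_continuous d (T : measurableType d) (R : realType)
    (eta : {measure set T -> \bar R}) (alpha beta : R)
    (J : Uad eta alpha beta -> R) : Prop :=
  forall (u_ : nat -> Uad eta alpha beta) (u : Uad eta alpha beta),
    weak_star_cvg (fun k => \val (u_ k)) (\val u) ->
    J (u_ k) @[k --> \oo] --> J u.

Definition bang_bang d (T : measurableType d) (R : realType)
    (eta : {measure set T -> \bar R}) (alpha beta : R)
    (u : Uad eta alpha beta) : Prop :=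
  \forall x \ae eta, (\val u x : R) = alpha \/ (\val u x : R) = beta.

Definition L1_local_minimizer d (T : measurableType d) (R : realType)
    (eta : {measure set T -> \bar R}) (alpha beta : R)
    (J : Uad eta alpha beta -> R) (ubar : Uad eta alpha beta) : Prop :=
  exists2 r : R, 0 < r &
    forall u : Uad eta alpha beta,
      (L1dist (\val u) (\val ubar) < r%:E)%E -> J ubar <= J u.

(* Main.v *)
(* On a set [A] where [alpha + rho <= ubar <= beta - rho], perturb [ubar] by
   [t * r_k] with [r_k = 1] on [B_k] and [r_k = -1] on [A `\` B_k], where [B_k]
   halves the measure of the first [k] traces on [A] of a countable dense family
   of measurable sets; such [B_k] exist by non-atomicity. Then [r_k] tends to
   [0] weak*, so that the values of [J] converge, while every perturbation has
   the same L^1 norm [t * eta A]. *)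
Require Import Defs.
From HB Require Import structures.
From mathcomp Require Import all_boot all_order all_algebra.
From mathcomp Require Import all_classical all_reals all_analysis.
From mathcomp Require Import measurable_realfun ess_sup_inf.
From mathcomp Require Import ring lra.

Set Implicit Arguments.
Unset Strict Implicit.
Unset Printing Implicit Defensive.

Import Order.TTheory GRing.Theory Num.Theory.
Import numFieldNormedType.Exports.

Local Open Scope classical_set_scope.
Local Open Scope ring_scope.

(** * Intermediate values and simultaneous halving for finite non-atomic measures *)

Section non_atomic_measure.
Context d (T : measurableType d) (R : realType).
Variable mu : {finite_measure set T -> \bar R}.
Implicit Types A B C E S : set T.

Let m A : R := fine (mu A).

Lemma fine_measureK A : measurable A -> (m A)%:E = mu A.
Proof. by move=> mA; rewrite /m fineK ?fin_num_measure. Qed.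

Lemma fine_measure_ge0 A : 0 <= m A.
Proof. exact: fine_ge0. Qed.

Lemma le_fine_measure A B : measurable A -> measurable B -> A `<=` B ->
  m A <= m B.
Proof.
by move=> mA mB AB; rewrite -lee_fin !fine_measureK// le_measure ?inE.
Qed.

Lemma fine_measureDI A B : measurable A -> measurable B ->
  m A = m (A `&` B) + m (A `\` B).
Proof.
move=> mA mB; apply: EFin_inj.
have mAB : measurable (A `&` B) by exact: measurableI.
have mDAB : measurable (A `\` B) by exact: measurableD.
by rewrite EFinD !fine_measureK// addeC; exact: measureDI.
Qed.

Lemma fine_measureU A B : measurable A -> measurable B -> A `&` B = set0 ->
  m (A `|` B) = m A + m B.
Proof.
move=> mA mB AB; apply: EFin_inj; rewrite EFinD !fine_measureK//.
  by rewrite measureU.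
exact: measurableU.
Qed.

Lemma fine_measureD A B : measurable A -> measurable B -> B `<=` A ->
  m (A `\` B) = m A - m B.
Proof.
move=> mA mB BA; rewrite [in RHS](fine_measureDI mA mB).
by rewrite (setIidr BA); lra.
Qed.

Lemma fine_measure_gt0 A : measurable A -> (0 < m A) = (0 < mu A)%E.
Proof. by move=> mA; rewrite -lte_fin fine_measureK. Qed.

Lemma fine_measure_bigcup_cvg (F : nat -> set T) :
  (forall n, measurable (F n)) -> nondecreasing_seq F ->
  m (F n) @[n --> \oo] --> m (\bigcup_n F n).
Proof.
move=> mF ndF; apply: fine_cvg; rewrite fine_measureK.
  by apply: nondecreasing_cvg_mu => //; exact: bigcupT_measurable.
exact: bigcupT_measurable.
Qed.

Hypothesis mu_non_atomic : non_atomic mu.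

(** Non-atomicity cuts [A] into two pieces of positive measure, and one of them carries at most half
    of [m A]. *)
Lemma non_atomic_le_half A : measurable A -> 0 < m A ->
  exists B, [/\ measurable B, B `<=` A, 0 < m B & m B <= m A / 2].
Proof.
move=> mA A0.
have [|B [mB BA muB0 ltmuBA]] := mu_non_atomic mA.
  by rewrite -fine_measure_gt0.
have B0 : 0 < m B by rewrite fine_measure_gt0.
have ltBA : m B < m A by rewrite -lte_fin !fine_measureK.
have mAB : measurable (A `\` B) by exact: measurableD.
have DE := fine_measureD mA mB BA.
have [le2|gt2] := leP (m B) (m A / 2); first by exists B.
exists (A `\` B); split => //; rewrite DE; lra.
Qed.

Lemma non_atomic_small A e : measurable A -> 0 < m A -> 0 < e ->
  exists B, [/\ measurable B, B `<=` A, 0 < m B & m B < e].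
Proof.
move=> mA A0 e0.
have halve n : exists B,
    [/\ measurable B, B `<=` A, 0 < m B & m B * 2 ^+ n <= m A].
  elim: n => [|n [B [mB BA B0 leB]]].
    by exists A; split => //; rewrite expr0 mulr1.
  have [C [mC CB C0 leC]] := non_atomic_le_half mB B0.
  exists C; split => //; first exact: subset_trans BA.
  apply: le_trans leB; rewrite exprS mulrA ler_wpM2r ?exprn_ge0//; lra.
(* With this number [n] of halvings, [m A / e < 2 ^+ n]. *)
have [B [mB BA B0]] := halve (Num.Def.archi_bound (m A / e)).
move=> leB; exists B; split => //.
have p0 : 0 < 2 ^+ (Num.Def.archi_bound (m A / e)) :> R by rewrite exprn_gt0.
rewrite -(ltr_pM2r p0); apply: le_lt_trans leB _.
by rewrite mulrC -ltr_pdivrMr// upper_nthrootP.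
Qed.

(* Greedy exhaustion: every step adds a set whose measure is at least half of
   the largest possible gain, so the limit cannot be enlarged any further. *)
Lemma non_atomic_intermediate E c : measurable E -> 0 <= c <= m E ->
  exists B, [/\ measurable B, B `<=` E & m B = c].
Proof.
move=> mE /andP[c0 cE].
pose ok B := [/\ measurable B, B `<=` E & m B <= c].
pose greedy B B' := [/\ ok B', B `<=` B' & forall C, measurable C ->
  C `<=` E `\` B -> m B + m C <= c -> m C <= 2 * (m B' - m B)].
have step B : ok B -> exists B', greedy B B'.
  move=> okB; have [mB BE Bc] := okB.
  pose G := [set m C | C in
    [set C | [/\ measurable C, C `<=` E `\` B & m B + m C <= c]]].
  have supG : has_sup G.
    split; first by exists (m set0), set0 => //; split => //;
      rewrite /m measure0 addr0.
    exists c => _ [C [mC _ leC] <-].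
    by have := fine_measure_ge0 B; lra.
  have leG C : measurable C -> C `<=` E `\` B -> m B + m C <= c ->
      m C <= sup G.
    by move=> mC CE leC; apply: sup_upper_bound => //; exists C.
  (* If no admissible set has positive measure, [B] itself serves as its successor. *)
  have [s0|s0] := leP (sup G) 0.
    exists B; split => // C mC CE leC.
    by rewrite subrr mulr0 (le_trans _ s0)// leG.
  (* The chosen gain exceeds [sup G / 2], hence half of every admissible gain. *)
  have [|_ [C [mC CE leC] <-] ltC] := sup_adherent _ supG (eps := sup G / 2).
    by rewrite divr_gt0.
  have BC : m (B `|` C) = m B + m C.
    rewrite fine_measureU//.
    by apply/seteqP; split => // x [Bx Cx]; have [] := CE _ Cx.
  exists (B `|` C); split; last 2 first.
  - by move=> x; left.
  - by move=> D mD DE leD; rewrite BC; have := leG D mD DE leD; lra.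
  - split; [exact: measurableU| |by rewrite BC].
    by move=> x [/BE//|/CE[]].
have [f fP] : {f : set T -> set T & forall B, ok B -> greedy B (f B)}.
  apply: (@choice _ _ (fun B B' => ok B -> greedy B B')) => B.
  (* Outside [ok] the value is an arbitrary default; the iterates from [set0] stay in [ok]. *)
  have [okB|nokB] := pselect (ok B); last by exists B.
  by have [B' ?] := step B okB; exists B'.
pose F n := iter n f set0.
have okF n : ok (F n).
  elim: n => [|n ih]; last by have [] := fP _ ih.
  by rewrite /F /=; split => //; rewrite /m measure0.
have mF n : measurable (F n) by have [] := okF n.
have ndF : nondecreasing_seq F.
  apply/nondecreasing_seqP => n; apply/subsetPset.
  by have [] := fP _ (okF n).
have cvgF := fine_measure_bigcup_cvg mF ndF.
set B := \bigcup_n F n in cvgF.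
have mB : measurable B by exact: bigcupT_measurable.
have BE : B `<=` E by apply: bigcup_sub => n _; have [] := okF n.
have Bc : m B <= c.
  have <- := cvg_lim (@Rhausdorff R) cvgF.
  apply: limr_le; first by apply/cvg_ex; exists (m B).
  by apply: nearW => n; have [] := okF n.
exists B; split => //; apply/eqP; rewrite eq_le Bc leNgt; apply/negP => Blt.
have mEB : measurable (E `\` B) by exact: measurableD.
(* If [m B < c], a non-null [C] still fits in [E] outside [B]. It was admissible at every stage, so
   its measure is at most twice each increment of [m (F n)], and these increments tend to 0. *)
have [||C [mC CE C0 ltC]] := non_atomic_small (e := c - m B) mEB.
- by rewrite fine_measureD//; lra.
- by lra.
suff : m C <= 2 * (m B - m B) by rewrite subrr mulr0 leNgt C0.
have cvgG : 2 * (m (F n.+1) - m (F n)) @[n --> \oo] --> 2 * (m B - m B).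
  apply: cvgM; [exact: cvg_cst|apply: cvgB => //].
  by rewrite -cvg_shiftS in cvgF.
rewrite -(cvg_lim (@Rhausdorff R) cvgG).
apply: limr_ge; first by apply/cvg_ex; eexists; exact: cvgG.
apply: nearW => n; have [_ _ ] := fP _ (okF n); apply => //.
  by move=> x /CE[Ex nBx]; split => // Fx; apply: nBx; exists n.
have FB : F n `<=` B by apply: bigcup_sup.
by have := le_fine_measure (mF n) mB FB; lra.
Qed.

(** Induction on [n] for all [E] at once: cut [E] along [S n], halve both pieces with respect to the
    earlier sets, and unite the halves. Additivity preserves the earlier conditions. *)
Lemma non_atomic_halving (S : nat -> set T) n E :
  (forall i, measurable (S i)) -> measurable E ->
  exists B, [/\ measurable B, B `<=` E, m B = m E / 2 &
    forall i, (i < n)%N -> m (B `&` S i) = m (E `&` S i) / 2].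
Proof.
move=> mS; elim: n E => [|n ih] E mE.
  have [|B [mB BE halfB]] := @non_atomic_intermediate E (m E / 2) mE.
    by have := fine_measure_ge0 E; rewrite /m; lra.
  by exists B.
have mI : measurable (E `&` S n) by exact: measurableI.
have mD : measurable (E `\` S n) by exact: measurableD.
have [B [mB BE halfB halfBS]] := ih _ mI.
have [C [mC CE halfC halfCS]] := ih _ mD.
have split_m D : measurable D -> m (E `&` D) =
    m ((E `&` S n) `&` D) + m ((E `\` S n) `&` D).
  move=> mDD; rewrite -fine_measureU; last 3 first.
  - exact: measurableI.
  - exact: measurableI.
  - by apply/seteqP; split => // x [[[_ ?] _] [[_ ?] _]].
  by rewrite -setIUl setUIDK.
have split_m' D : measurable D -> m ((B `|` C) `&` D) =
    m (B `&` D) + m (C `&` D).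
  move=> mDD; rewrite -fine_measureU; last 3 first.
  - exact: measurableI.
  - exact: measurableI.
  - by apply/seteqP; split => // x [[/BE[_ ?] _] [/CE[_ ?] _]].
  by rewrite -setIUl.
exists (B `|` C); split.
- exact: measurableU.
- by move=> x [/BE[]|/CE[]].
- have := split_m _ measurableT; have := split_m' _ measurableT.
  by rewrite !setIT; lra.
- move=> i; rewrite ltnS leq_eqVlt => /predU1P[->|lti]; last first.
    by rewrite split_m'// split_m// halfBS// halfCS//; lra.
  (* For the new index only [B] meets [S n], and it lies inside it, so the condition reduces to
     [halfB]. *)
  rewrite split_m'// (setIidl (B := S n)); last by move=> x /BE[].
  rewrite (_ : C `&` S n = set0); first by rewrite {2}/m measure0 addr0.
  by apply/seteqP; split => // x [/CE[]].
Qed.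

Hypothesis mu_separable : separable_measure mu.

(** A member [S_ n] of the dense family is halved exactly by all later [B k]; passing from [S] to
    [S_ n] costs at most the measure of their symmetric difference. *)
Lemma non_atomic_halving_cvg E : measurable E ->
  exists B : nat -> set T,
    [/\ forall k, measurable (B k), forall k, B k `<=` E &
     forall S, measurable S ->
       m (B k `&` S) @[k --> \oo] --> m (E `&` S) / 2].
Proof.
move=> mE; have [S_ [mS_ denseS]] := mu_separable.
have /choice[B BP] k := non_atomic_halving k mS_ mE.
have mB k : measurable (B k) by have [] := BP k.
exists B; split => // [k|S mS]; first by have [] := BP k.
apply/cvgrPdist_lt => e e0; have e2 : 0 < e / 2 by rewrite divr_gt0.
have [n lteD] := denseS S _ mS e2.
have mD1 : measurable (S `\` S_ n) by exact: measurableD.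
have mD2 : measurable (S_ n `\` S) by exact: measurableD.
have lte : m (S `\` S_ n) + m (S_ n `\` S) < e / 2.
  rewrite -fine_measureU//.
    by rewrite -lte_fin fine_measureK//; exact: measurableU.
  by apply/seteqP; split => // x [[? ?] []].
(* [B k] halves only the traces of index below [k], so index [n] requires [k] to be at least
   [n.+1]. *)
exists n.+1 => // k /= ltnk.
have [_ BE _ /(_ n ltnk) half] := BP k.
(* Both sides measure the trace on [A] of the union of [S] and [S_ n]. *)
have split_m A : measurable A -> m (A `&` S) + m (A `&` (S_ n `\` S)) =
    m (A `&` S_ n) + m (A `&` (S `\` S_ n)).
  move=> mA; rewrite -!fine_measureU; first last.
  - by apply/seteqP; split => // x [[_ ?] [_ []]].
  - exact: measurableI.
  - exact: measurableI.
  - by apply/seteqP; split => // x [[_ ?] [_ []]].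
  - exact: measurableI.
  - exact: measurableI.
  congr m; rewrite -!setIUr !setDE.
  by rewrite !setUIr !setUv !setIT [in RHS]setUC.
have leI A D : measurable A -> measurable D -> 0 <= m (A `&` D) <= m D.
  move=> mA mD; rewrite fine_measure_ge0/= le_fine_measure//.
  exact: measurableI.
have := split_m _ mE; have := split_m _ (mB k).
have := leI _ _ mE mD1; have := leI _ _ mE mD2.
have := leI _ _ (mB k) mD1; have := leI _ _ (mB k) mD2.
move: half lte; rewrite ltr_norml.
(* The measures become real variables, which leaves a purely linear problem. *)
move: (m _) (m _) (m _) (m _) (m _) (m _) (m _) (m _) (m _) (m _).
move=> *; lra.
Qed.

End non_atomic_measure.

(** * Convergence against integrable functions, from convergence against indicators *)

Section bounded_multipliers.
Import HBSimple.
Context d (T : measurableType d) (R : realType).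
Variable mu : {finite_measure set T -> \bar R}.

Lemma integrable_mul_bounded (g h : T -> R) (M : R) :
  mu.-integrable setT (EFin \o g) -> measurable_fun setT h ->
  (forall x, `|h x| <= M) -> mu.-integrable setT (EFin \o (g \* h)).
Proof.
move=> ig mh hM; apply: (integrableMl measurableT ig mh).
by exists M; split; [exact: num_real|move=> y /ltW My x _; exact: le_trans My].
Qed.

Lemma Rintegral_indic (S : set T) : measurable S ->
  \int[mu]_x \1_S x = fine (mu S).
Proof. by move=> mS; rewrite /Rintegral integral_indic// setIT. Qed.

Variables (h : nat -> T -> R) (M : R).
Hypothesis mh : forall k, measurable_fun setT (h k).
Hypothesis hM : forall k x, `|h k x| <= M.
Hypothesis h_indic : forall S, measurable S ->
  (\int[mu]_x (\1_S x * h k x)) @[k --> \oo] --> (0 : R).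

Lemma Rintegral_sfun_mul_cvg0 (g : {sfun T >-> R}) :
  (\int[mu]_x (g x * h k x)) @[k --> \oo] --> (0 : R).
Proof.
(* Integrability is carried along because additivity of the real-valued integral requires it. *)
pose P (f : T -> R) := mu.-integrable setT (EFin \o f) /\
  (\int[mu]_x (f x * h k x)) @[k --> \oo] --> (0 : R).
have P0 : P 0.
  split; first exact: integrable0.
  under eq_fun do under eq_Rintegral do rewrite mul0r.
  by rewrite /Rintegral integral0; exact: cvg_cst.
have PD f1 f2 : P f1 -> P f2 -> P (f1 + f2).
  move=> [if1 cf1] [if2 cf2]; split.
    exact: (integrableD measurableT if1 if2).
  rewrite -[X in _ --> X]addr0; under eq_fun.
    move=> k; under eq_Rintegral do rewrite mulrDl.
    by rewrite RintegralD//; [over|exact: integrable_mul_bounded (hM k)..].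
  exact: cvgD.
have PZ a S : measurable S -> P (fun x => a * \1_S x).
  move=> mS; split.
    exact: (integrableZl measurableT a (integrable_indic mu mS)).
  rewrite -[X in _ --> X](mulr0 a); under eq_fun.
    move=> k; under eq_Rintegral do rewrite -mulrA.
    rewrite RintegralZl//; first over.
    exact: integrable_mul_bounded (integrable_indic mu mS) (mh k) (hM k).
  by apply: cvgM; [exact: cvg_cst|exact: h_indic].
suff [] : P g by [].
have -> : (g : T -> R) =
    \sum_(y <- finmap.enum_fset (fset_set (range g)))
      (fun x => y * \1_(g @^-1` [set y]) x).
  by apply/funext => x; rewrite fimfunE fsbig_finite// fct_sumE.
by apply: big_ind => // y _; apply: PZ.
Qed.

(** Simple functions are dense in L^1, and replacing [g] by a simple [s] changes each integral by at
    most [M] times the L^1 norm of [g - s], uniformly in [k]. *)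
Lemma Rintegral_mul_cvg0 (g : T -> R) : mu.-integrable setT (EFin \o g) ->
  (\int[mu]_x (g x * h k x)) @[k --> \oo] --> (0 : R).
Proof.
move=> ig; apply/cvgrPdist_lt => e e0.
have M0 : 0 <= M by exact: le_trans (hM 0 point).
have [s_ [is_ _ /fine_cvgP[_ /cvgrPdist_lt]]] :=
  approximation_sfun_integrable measurableT ig.
(* [M + 1] replaces [M] to keep the denominator positive when [M = 0]. *)
have d0 : 0 < e / (2 * (M + 1)) by rewrite divr_gt0//; lra.
move=> /(_ _ d0) [n _ /(_ n (leqnn n))] /=.
rewrite sub0r normrN => ltn.
have e2 : 0 < e / 2 by rewrite divr_gt0.
have /cvgrPdist_lt /(_ _ e2) := Rintegral_sfun_mul_cvg0 (s_ n).
apply: filterS => k; rewrite !sub0r !normrN => ltk.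
have igs : mu.-integrable setT (EFin \o (g \- s_ n)).
  exact: (integrableB measurableT ig (is_ n)).
have -> : \int[mu]_x (g x * h k x) =
    \int[mu]_x (s_ n x * h k x) + \int[mu]_x ((g \- s_ n) x * h k x).
  rewrite -RintegralD//; last 2 first.
  - exact: integrable_mul_bounded (hM k).
  - exact: integrable_mul_bounded (hM k).
  by apply: eq_Rintegral => x _ /=; ring.
have leM : `|\int[mu]_x ((g \- s_ n) x * h k x)| <=
    M * \int[mu]_x `|(g \- s_ n) x|.
  have igsh : mu.-integrable setT (EFin \o ((g \- s_ n) \* h k)).
    exact: integrable_mul_bounded (hM k).
  apply: le_trans (le_normr_Rintegral measurableT igsh) _.
  rewrite -RintegralZl//; last exact: integrable_norm.
  apply: le_Rintegral => //.
  - exact: integrable_norm igsh.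
  - by have := integrableZl measurableT M (integrable_norm igs).
  - by move=> x _; rewrite /= normrM mulrC ler_wpM2r.
have ltn' : \int[mu]_x `|(g \- s_ n) x| < e / (2 * (M + 1)).
  by apply: le_lt_trans ltn; rewrite ler_norm.
have leM' : M * \int[mu]_x `|(g \- s_ n) x| <= e / 2.
  have -> : e / 2 = (M + 1) * (e / (2 * (M + 1))) by field; lra.
  apply: ler_pM => //; [|lra|exact: ltW].
  exact: Rintegral_ge0.
apply: le_lt_trans (ler_normD _ _) _; lra.
Qed.

End bounded_multipliers.

(** * From bounded measurable functions to admissible classes *)

Section admissible_controls.
Context d (T : measurableType d) (R : realType).
Variables (mu : {finite_measure set T -> \bar R}) (alpha beta : R).

Lemma Uad_exists (f : T -> R) : measurable_fun setT f ->
  (\forall x \ae mu, alpha <= f x <= beta) ->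
  exists u : Uad mu alpha beta, \forall x \ae mu, (\val u x : R) = f x.
Proof.
move=> mf fab.
pose f0 := @mfun_Sub _ _ T (measurableTypeR R) f (mem_set mf).
(* The representative chosen for the class of [f] agrees with [f] only almost everywhere, hence the
   form of the conclusion. *)
pose q : {mfun_ mu, T >-> measurableTypeR R} :=
  (\pi_({mfun_ mu, T >-> measurableTypeR R}) f0)%qT.
have qf : \forall x \ae mu, (q x : R) = f x.
  have /eqP : (repr q = f0 %[mod {mfun_ mu, T >-> measurableTypeR R}])%qT.
    by rewrite reprK.
  by rewrite eqmodE => /asboolP; apply: filterS => x /(_ Logic.I).
have fin : finite_norm mu +oo q.
  rewrite /finite_norm unlock; case: ifPn => // _.
  apply: (@le_lt_trans _ _ (`|alpha| + `|beta|)%:E); last exact: ltry.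
  apply/ess_supP; move: qf fab; apply: filterS2 => x /= -> /andP[a b].
  rewrite lee_fin ler_norml; apply/andP; split.
  - have := ler_norm (- alpha); rewrite normrN; have := normr_ge0 beta; lra.
  - have := ler_norm beta; have := normr_ge0 alpha; lra.
pose u : Linfty mu :=
  HB.pack q (isFinLebesgue.Build _ _ _ mu +oo%E (leey 1%E) q fin).
have uab : Uad mu alpha beta u.
  by move: qf fab; apply: filterS2 => x /= ->.
by exists (SigSub (mem_set uab)).
Qed.
End admissible_controls.

(** * Almost everywhere equality, and the region where a control stays off its bounds *)

Section ae_equal.
Context d (T : measurableType d) (R : realType).
Variable mu : {measure set T -> \bar R}.

Lemma ae_eq_Rintegral (f g : T -> R) :
  measurable_fun setT f -> measurable_fun setT g ->
  (\forall x \ae mu, f x = g x) -> \int[mu]_x f x = \int[mu]_x g x.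
Proof.
move=> mf mg fg; congr fine; apply: ae_eq_integral => //.
- exact/measurable_EFinP.
- exact/measurable_EFinP.
- by apply: filterS fg => x /= ->.
Qed.

(** The set where [alpha < f < beta] is the countable union of the sets [A n] with margin
    [n.+1%:R^-1]; if all were null, [f] would be bang-bang. *)
Lemma not_bang_bang_interior (f : T -> R) (alpha beta : R) :
  measurable_fun setT f -> (forall x, alpha <= f x <= beta) ->
  ~ (\forall x \ae mu, f x = alpha \/ f x = beta) ->
  exists2 rho : R, 0 < rho &
    (0 < mu (f @^-1` `[(alpha + rho)%R, (beta - rho)%R]))%E.
Proof.
move=> mf fab nbb; apply: contrapT => null; apply: nbb.
pose A n := f @^-1` `[(alpha + n.+1%:R^-1), (beta - n.+1%:R^-1)].
have mA n : measurable (A n).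
  by rewrite -[A n]setTI; apply: mf => //; exact: measurable_itv.
have A0 n : mu (A n) = 0.
  apply/eqP; rewrite eq_le measure_ge0 andbT leNgt; apply/negP => pos.
  by apply: null; exists n.+1%:R^-1.
have : \forall x \ae mu, forall n, ~ A n x.
  apply: ae_foralln => n; exists (A n); split => //.
  by move=> x /= /contrapT.
apply: filterS => x nA; apply: contrapT => /not_orP[/eqP nal /eqP nbe].
have /andP[ax xb] := fab x.
have gap : 0 < Num.min (f x - alpha) (beta - f x).
  by rewrite lt_min !subr_gt0 !lt_neqAle ax xb (eq_sym alpha) nal nbe.
have [n] := ltr_add_invr gap; rewrite add0r lt_min => /andP[ltl ltr].
apply: (nA n); rewrite /A /= in_itv/=.
by move: ltl ltr; set c := n.+1%:R^-1 => ltl ltr; apply/andP; split; lra.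
Qed.

End ae_equal.

(** * Pointwise representatives of Lebesgue classes *)

Section admissible_representatives.
Context d (T : measurableType d) (R : realType).
Variables (mu : {measure set T -> \bar R}) (alpha beta : R).

Lemma measurable_ae_class (u : {mfun_ mu, T >-> measurableTypeR R}) :
  measurable_fun setT (u : T -> R).
Proof. exact: (measurable_funPT (repr u)). Qed.

Lemma integrable_L1 (g : LspaceType1 mu) :
  mu.-integrable setT (EFin \o (g : T -> R)).
Proof.
apply/Lfun1_integrable; rewrite inE; apply/andP; split; rewrite inE/=.
  exact: measurable_ae_class.
exact: Lebesgue_finite.
Qed.

(** Truncating to [[alpha, beta]] alters the chosen representative only on a null set. *)
Lemma Uad_bounded_repr (u : Uad mu alpha beta) : alpha <= beta ->
  exists f : T -> R, [/\ measurable_fun setT f,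
    forall x, alpha <= f x <= beta & \forall x \ae mu, (\val u x : R) = f x].
Proof.
move=> ab; exists (fun x => Num.max alpha (Num.min beta (\val u x : R))); split.
- apply: measurable_maxr => //; apply: measurable_minr => //.
  exact: measurable_ae_class.
- by move=> x; rewrite le_max lexx/= ge_max ab ge_min lexx.
- have := set_mem (valP u); apply: filterS => x /= /andP[au ub].
  by rewrite min_r// max_r.
Qed.

Lemma L1distE (u v : Linfty mu) (f g : T -> R) :
  measurable_fun setT f -> measurable_fun setT g ->
  (\forall x \ae mu, (u x : R) = f x) -> (\forall x \ae mu, (v x : R) = g x) ->
  L1dist u v = (\int[mu]_x `|f x - g x|%:E)%E.
Proof.
move=> mf mg uf vg; rewrite /L1dist Lnorm1; apply: ae_eq_integral => //.
- apply: measurableT_comp => //; apply/measurable_EFinP.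
  by apply: measurable_funB; exact: measurable_ae_class.
- apply/measurable_EFinP; apply: measurableT_comp => //.
  exact: measurable_funB.
- by move: uf vg; apply: filterS2 => x /= -> ->.
Qed.

End admissible_representatives.

(** * The two-valued perturbation: its norm and its weak limit *)

Section halving_perturbation.
Context d (T : measurableType d) (R : realType).
Variable mu : {finite_measure set T -> \bar R}.

(* When [B `<=` A], this is [t] on [B], [- t] on [A `\` B] and [0] off [A]. *)
Definition two_valued (A B : set T) (t : R) (x : T) : R :=
  t * (2 * \1_B x - \1_A x).

Lemma measurable_two_valued A B t : measurable A -> measurable B ->
  measurable_fun setT (two_valued A B t).
Proof.
move=> mA mB; apply: measurable_funM => //; apply: measurable_funB => //.
exact: measurable_funM.
Qed.

(** The factor of [t] is a sign on [A] and vanishes elsewhere. The modulus is thus independent of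
    [B], which fixes the L^1 norm along the sequence. *)
Lemma norm_two_valued A B t x : B `<=` A -> 0 <= t ->
  `|two_valued A B t x| = t * \1_A x.
Proof.
move=> BA t0; rewrite /two_valued normrM ger0_norm// !indicE; congr (_ * _).
have [xB|xB] := boolP (x \in B).
  have -> : x \in A by apply/mem_set/BA; exact: set_mem.
  by rewrite /= mulr1 ger0_norm; lra.
by case: (x \in A); rewrite mulr0 sub0r normrN normr_nat.
Qed.

Lemma integral_norm_two_valued A B t : measurable A -> B `<=` A -> 0 <= t ->
  (\int[mu]_x `|two_valued A B t x|%:E)%E = (t * fine (mu A))%:E.
Proof.
move=> mA BA t0; under eq_integral do rewrite norm_two_valued// EFinM.
rewrite integralZl//; last exact: integrable_indic.
by rewrite integral_indic// setIT EFinM fine_measureK.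
Qed.

Lemma Rintegral_indic_two_valued A B S t :
  measurable A -> measurable B -> measurable S ->
  \int[mu]_x (\1_S x * two_valued A B t x) =
  2 * t * fine (mu (B `&` S)) - t * fine (mu (A `&` S)).
Proof.
move=> mA mB mS.
have mAS : measurable (A `&` S) by exact: measurableI.
have mBS : measurable (B `&` S) by exact: measurableI.
have iA := integrable_indic mu mAS; have iB := integrable_indic mu mBS.
rewrite -(Rintegral_indic mu mAS) -(Rintegral_indic mu mBS).
rewrite -RintegralZl// -RintegralZl// -RintegralB//; last 2 first.
- exact: (integrableZl measurableT (2 * t) iB).
- exact: (integrableZl measurableT t iA).
by apply: eq_Rintegral => x _; rewrite /two_valued !indicI /=; ring.
Qed.

(** Against the indicator of [S] the halving makes the two terms of the integral cancel in the
    limit; the uniform bound [t] extends this to integrable [g]. *)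
Lemma two_valued_weak_cvg0 A (B : nat -> set T) t (g : T -> R) :
  measurable A -> (forall k, measurable (B k)) -> (forall k, B k `<=` A) ->
  (forall S, measurable S ->
    fine (mu (B k `&` S)) @[k --> \oo] --> fine (mu (A `&` S)) / 2) ->
  0 <= t -> mu.-integrable setT (EFin \o g) ->
  (\int[mu]_x (g x * two_valued A (B k) t x)) @[k --> \oo] --> (0 : R).
Proof.
move=> mA mB BA half t0 ig; apply: (@Rintegral_mul_cvg0 _ _ _ _ _ t) => //.
- by move=> k; exact: measurable_two_valued.
- by move=> k x; rewrite norm_two_valued// indicE ler_piMr// lern1 leq_b1.
- move=> S mS; under eq_fun do rewrite Rintegral_indic_two_valued//.
  rewrite (_ : 0 = 2 * t * (fine (mu (A `&` S)) / 2) - t * fine (mu (A `&` S))).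
    apply: cvgB; last exact: cvg_cst.
    by apply: cvgM; [exact: cvg_cst|exact: half].
  by field.
Qed.

End halving_perturbation.

(** * Perturbing the control and passing to the limit in [J] *)

Theorem theorem2p1 (R : realType) (d : measure_display) (X : measurableType d)
    (eta : {finite_measure set X -> \bar R})
    (eta_complete : measure_is_complete eta)
    (eta_separable : separable_measure eta)
    (eta_non_atomic : non_atomic eta)
    (alpha beta : R) (alpha_lt_beta : alpha < beta)
    (J : Uad eta alpha beta -> R)
    (J_continuous : weak_star_seq_continuous J)
    (ubar : Uad eta alpha beta)
    (ubar_min : L1_local_minimizer J ubar)
    (ubar_not_bang_bang : ~ bang_bang ubar) :
  exists2 delta0 : R, 0 < delta0 &
    forall delta : R, 0 < delta <= delta0 ->
    forall e : R, 0 < e ->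
    exists u : Uad eta alpha beta,
      L1dist (\val u) (\val ubar) = delta%:E /\ J u <= J ubar + e.
Proof.
have [w [mw wab ubarw]] := Uad_bounded_repr ubar (ltW alpha_lt_beta).
have [|rho rho0] := @not_bang_bang_interior _ _ _ eta w alpha beta mw wab.
  move=> wbb; apply: ubar_not_bang_bang.
  by move: wbb ubarw; apply: filterS2 => x /= ? ->.
set A := w @^-1` _ => A0.
have mA : measurable A.
  by rewrite -[A]setTI; apply: mw => //; exact: measurable_itv.
have a0 : 0 < fine (eta A) by rewrite fine_measure_gt0.
have [B [mB BA half]] := non_atomic_halving_cvg eta_non_atomic eta_separable mA.
(* Distance [delta] forces the amplitude [t = delta / eta A]; this choice of [delta0] gives
   [t <= rho], so the perturbation respects the bounds on [A]. *)
exists (rho * fine (eta A)) => [|delta /andP[delta_gt0 delta_le] e e0].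
  exact: mulr_gt0.
pose t := delta / fine (eta A).
have t0 : 0 <= t by rewrite divr_ge0// ltW.
have trho : t <= rho by rewrite ler_pdivrMr.
pose h k := two_valued A (B k) t.
have mh k : measurable_fun setT (h k) by exact: measurable_two_valued.
have mwh k : measurable_fun setT (w \+ h k) by exact: measurable_funD.
have wh_ab k x : alpha <= w x + h k x <= beta.
  have hk : `|h k x| = t * \1_A x by exact: norm_two_valued.
  have := ler_norm (h k x); have := ler_norm (- h k x); rewrite normrN hk.
  have /andP[] := wab x; rewrite indicE; have [xA|xA] := boolP (x \in A).
    have := set_mem xA; rewrite /A /= in_itv/= mulr1 => /andP[] *.
    by apply/andP; split; lra.
  by rewrite mulr0 => *; apply/andP; split; lra.
have /choice[u_ u_wh] k : exists u : Uad eta alpha beta,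
    \forall x \ae eta, (\val u x : R) = w x + h k x.
  apply: (@Uad_exists _ _ _ _ _ _ (w \+ h k)) => //.
  by apply: nearW => x; exact: wh_ab.
have dist k : L1dist (\val (u_ k)) (\val ubar) = delta%:E.
  rewrite (L1distE (mwh k) mw (u_wh k) ubarw).
  under eq_integral do rewrite /= addrAC subrr add0r.
  by rewrite integral_norm_two_valued// /t divfK// gt_eqF.
(* The integral against [g] splits into a constant part with [w] and a part with [h k] that tends to
   0. *)
have weak : weak_star_cvg (fun k => \val (u_ k)) (\val ubar).
  move=> g; have ig := integrable_L1 g.
  have mg : measurable_fun setT (g : X -> R) by exact: measurable_ae_class.
  have igh k : eta.-integrable setT (EFin \o ((g : X -> R) \* h k)).
    apply: (@integrable_mul_bounded _ _ _ _ _ _ t) => // x.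
    by rewrite norm_two_valued// indicE ler_piMr// lern1 leq_b1.
  have igw : eta.-integrable setT (EFin \o ((g : X -> R) \* w)).
    apply: (@integrable_mul_bounded _ _ _ _ _ _ (`|alpha| + `|beta|)) => // x.
    have /andP[aw wb] := wab x; rewrite ler_norml; apply/andP; split.
    - have := ler_norm (- alpha); rewrite normrN.
      by have := normr_ge0 beta; lra.
    - by have := ler_norm beta; have := normr_ge0 alpha; lra.
  have -> : \int[eta]_x ((g x : R) * (\val ubar x : R)) =
      \int[eta]_x (g x * w x).
    apply: ae_eq_Rintegral.
    - by apply: measurable_funM => //; exact: measurable_ae_class.
    - exact: measurable_funM.
    - by apply: filterS ubarw => x /= ->.
  have Eu k : \int[eta]_x ((g x : R) * (\val (u_ k) x : R)) =
      \int[eta]_x (g x * w x) + \int[eta]_x (g x * h k x).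
    rewrite -(RintegralD measurableT igw (igh k)); apply: ae_eq_Rintegral.
    - by apply: measurable_funM => //; exact: measurable_ae_class.
    - by apply: measurable_funD; exact: measurable_funM.
    - by apply: filterS (u_wh k) => x /= ->; rewrite mulrDr.
  have : (\int[eta]_x (g x * w x) + \int[eta]_x (g x * h k x)) @[k --> \oo] -->
      \int[eta]_x (g x * w x) + 0.
    by apply: cvgD; [exact: cvg_cst|exact: two_valued_weak_cvg0].
  by rewrite addr0; under eq_fun do rewrite -Eu.
(* All [u_ k] lie at distance [delta], so a single index with [J (u_ k)] within [e] of [J ubar]
   suffices. *)
have /cvgrPdist_lt/(_ _ e0)[k _ /(_ k (leqnn k))] := J_continuous _ _ weak.
rewrite /= distrC => ltJ; exists (u_ k); split; first exact: dist.
by rewrite -lerBlDl; exact: le_trans (ler_norm _) (ltW ltJ).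
Qed.
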